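(* Let $\kappa$ be a cardinal with $\kappa \le 2^{\omega} < 2^{\kappa}$. Then there exist $2^{\kappa}$ pairwise nonisomorphic Banach spaces of the form $C(L)$, where $L$ is a separable compact linearly ordered space of weight $\kappa$.
   Context: A compact linearly ordered space (compact line) is a linearly ordered set whose order topology is compact (Hausdorff). For a compact space $L$, $C(L)$ is the Banach space of continuous real-valued functions on $L$ with the supremum norm. Banach spaces are isomorphic if there is a bounded linear bijection between them with bounded inverse. The weight of a space is the least cardinality of a base of its topology. $2^\omega$ is the cardinality of the continuum. *)

(* Defs.v *)
From HB Require Import structures.
From mathcomp Require Import all_boot all_order all_algebra.
From mathcomp Require Import all_classical all_reals all_analysis.
From mathcomp Require Import lra.

Set Implicit Arguments.
Unset Strict Implicit.
Unset Printing Implicit Defensive.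

Import Order.TTheory GRing.Theory Num.Theory.
Import numFieldNormedType.Exports.

Local Open Scope classical_set_scope.
Local Open Scope card_scope.
Local Open Scope ring_scope.

HB.mixin Record Topological_isCompact T & Topological T := {
  compact_setT : compact [set: T]
}.

#[short(type="compactType")]
HB.structure Definition CompactTopological :=
  { T of Topological T & Topological_isCompact T }.

(* No Hausdorff axiom is needed: order topologies are Hausdorff. *)
#[short(type="compactLineType")]
HB.structure Definition CompactLine d :=
  { T of OrderTopological d T & Topological_isCompact T }.

Definition separable_space (T : topologicalType) :=
  exists2 D : set T, countable D & dense D.

(* Cardinals are represented by types: [K] stands for the cardinality of
   [[set: K]], and 2^K is represented by [set K]. *)
Definition has_weight (T : topologicalType) (K : Type) :=
  (exists2 B : set (set T), basis B & B #= [set: K]) /\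
  (forall B : set (set T), basis B -> [set: K] #<= B).

Definition card_lt T U (A : set T) (B : set U) := (A #<= B) && ~~ (B #<= A).

Definition Cspace (R : realType) (L : compactType) : Type :=
  continuousType L R.

Section Cspace_lmodule.
Context {R : realType} {L : compactType}.
Local Notation C := (Cspace R L).
Implicit Types (f g h : C) (a b : R).

HB.instance Definition _ := Choice.copy C (continuousType L R).

Lemma CspaceP f g : (forall x, f x = g x) -> f = g.
Proof. by move=> fg; apply/continuousEP. Qed.

Lemma Ccst_subproof : continuous (fun _ : L => 0 : R).
Proof. by move=> x; exact: cvg_cst. Qed.

Lemma Copp_subproof f : continuous (fun x => - f x).
Proof. by move=> x; apply: cvgN; exact: cts_fun. Qed.

Lemma Cadd_subproof f g : continuous (fun x => f x + g x).
Proof. by move=> x; apply: cvgD; exact: cts_fun. Qed.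

Lemma Cscale_subproof a f : continuous (fun x => a * f x).
Proof. by move=> x; apply: cvgMl_tmp; exact: cts_fun. Qed.

Definition Czero : C := mkcts Ccst_subproof.
Definition Copp f : C := mkcts (@Copp_subproof f).
Definition Cadd f g : C := mkcts (@Cadd_subproof f g).
Definition Cscale a f : C := mkcts (@Cscale_subproof a f).

Lemma CaddA : associative Cadd.
Proof. by move=> f g h; apply: CspaceP => x; exact: addrA. Qed.

Lemma CaddC : commutative Cadd.
Proof. by move=> f g; apply: CspaceP => x; exact: addrC. Qed.

Lemma Cadd0 : left_id Czero Cadd.
Proof. by move=> f; apply: CspaceP => x; exact: add0r. Qed.

Lemma CaddN : left_inverse Czero Copp Cadd.
Proof. by move=> f; apply: CspaceP => x; exact: addNr. Qed.

HB.instance Definition _ := GRing.isZmodule.Build C CaddA CaddC Cadd0 CaddN.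

Lemma CscaleA a b f : Cscale a (Cscale b f) = Cscale (a * b) f.
Proof. by apply: CspaceP => x; exact: mulrA. Qed.

Lemma Cscale1 : left_id 1 Cscale.
Proof. by move=> f; apply: CspaceP => x; exact: mul1r. Qed.

Lemma CscaleDr : right_distributive Cscale +%R.
Proof. by move=> a f g; apply: CspaceP => x; exact: mulrDr. Qed.

Lemma CscaleDl f : {morph Cscale^~ f : a b / a + b}.
Proof. by move=> a b; apply: CspaceP => x; exact: mulrDl. Qed.

HB.instance Definition _ :=
  GRing.Zmodule_isLmodule.Build R C CscaleA Cscale1 CscaleDr CscaleDl.

Lemma CaddE f g x : (f + g) x = f x + g x. Proof. by []. Qed.
Lemma CoppE f x : (- f) x = - f x. Proof. by []. Qed.
Lemma CscaleE a f x : (a *: f) x = a * f x. Proof. by []. Qed.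
Lemma CzeroE x : (0 : C) x = 0. Proof. by []. Qed.

Definition Cnorm f : R := sup (range (fun x => `|f x|)).

Lemma has_ubound_Cnorm f : has_ubound (range (fun x => `|f x|)).
Proof.
have : compact (f @` [set: L]).
  apply: continuous_compact; last exact: compact_setT.
  exact: continuous_subspaceT (@cts_fun _ _ f).
move=> /compact_bounded[M [_ fM]]; exists (M + 1) => _ [x _ <-].
by apply: (fM _ _ (f x)); [rewrite ltrDl | exists x].
Qed.

Lemma le_Cnorm f x : `|f x| <= Cnorm f.
Proof. by apply: ub_le_sup; [exact: has_ubound_Cnorm | exists x]. Qed.

Lemma Cnorm_ge0 f : 0 <= Cnorm f.
Proof.
have [[_ [x _ _]]|/set0P/negP/negPn/eqP e] := pselect (range (fun x => `|f x|) !=set0).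
  exact: le_trans (le_Cnorm f x).
by rewrite /Cnorm e sup0.
Qed.

Lemma Cnorm_le f (M : R) : 0 <= M -> (forall x, `|f x| <= M) -> Cnorm f <= M.
Proof.
move=> M0 fM.
have [ne|/set0P/negP/negPn/eqP e] := pselect (range (fun x => `|f x|) !=set0).
  by apply: ge_sup => // _ [x _ <-].
by rewrite /Cnorm e sup0.
Qed.

Lemma CnormD f g : Cnorm (f + g) <= Cnorm f + Cnorm g.
Proof.
apply: Cnorm_le => [|x]; first by rewrite addr_ge0 ?Cnorm_ge0.
by rewrite CaddE (le_trans (ler_normD _ _))// lerD ?le_Cnorm.
Qed.

Lemma CnormZ a f : Cnorm (a *: f) = `|a| * Cnorm f.
Proof.
have le b h : Cnorm (b *: h) <= `|b| * Cnorm h.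
  apply: Cnorm_le => [|x]; first by rewrite mulr_ge0 ?Cnorm_ge0.
  by rewrite CscaleE normrM ler_wpM2l ?le_Cnorm.
apply/eqP; rewrite eq_le le/=.
have [->|a0] := eqVneq a 0; first by rewrite normr0 mul0r Cnorm_ge0.
have := le a^-1 (a *: f).
by rewrite scalerA mulVf// scale1r normfV ler_pdivlMl ?normr_gt0.
Qed.

Lemma Cnorm_eq0 f : Cnorm f = 0 -> f = 0.
Proof.
move=> f0; apply: CspaceP => x; apply/eqP.
by rewrite CzeroE -normr_le0 -f0 le_Cnorm.
Qed.

HB.instance Definition _ := Lmodule_isNormed.Build R C CnormD CnormZ Cnorm_eq0.

Lemma Cspace_normE f : `|f| = sup (range (fun x => `|f x|)).
Proof. by []. Qed.

Lemma Cspace_complete (F : set_system C) :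
  ProperFilter F -> cauchy F -> cvg F.
Proof.
move=> FF /cauchy_ballP Fc.
have Fe e : 0 < e -> exists2 A, F A & forall f g, A f -> A g -> `|f - g| < e.
  move=> e0; have [[A B]/= [FA FB] AB] := Fc _ e0.
  exists (A `&` B); first exact: filterI.
  move=> f g [Af _] [_ Bg]; have := AB (f, g) (conj Af Bg).
  by rewrite /= -ball_normE.
have le_ev f g x : `|f x - g x| <= `|f - g| := le_Cnorm (f - g) x.
pose ev (x : L) f : R := f x.
have cvx x : cvg (ev x @ F).
  apply: cauchy_cvg; apply/cauchy_exP => e e0.
  have [A FA Ae] := Fe _ e0.
  have [f Af] := filter_ex FA.
  exists (f x); change (F (ev x @^-1` ball (f x) e)).
  apply: filterS FA => g Ag; rewrite /= -ball_normE/=.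
  exact: le_lt_trans (le_ev f g x) (Ae _ _ Af Ag).
pose l x := lim (ev x @ F).
have lE e : 0 < e -> exists2 A, F A & forall f x, A f -> `|f x - l x| <= e.
  move=> e0; have [A FA Ae] := Fe _ e0; exists A => // f x Af.
  have cl : `|f x - ev x g| @[g --> F] --> `|f x - l x|.
    by apply: cvg_norm; apply: cvgB; [exact: cvg_cst | exact: cvx].
  rewrite -(cvg_lim _ cl)//; apply: limr_le; first by apply/cvg_ex; eexists; exact: cl.
  apply: filterS FA => g Ag; apply: ltW.
  exact: le_lt_trans (le_ev f g x) (Ae _ _ Af Ag).
have lc : continuous l.
  move=> x; apply/cvgrPdist_lt => e e0.
  have e3 : 0 < e / 3 by rewrite divr_gt0.
  have [A FA Al] := lE _ e3.
  have [f Af] := filter_ex FA.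
  have /cvgrPdist_lt/(_ _ e3) := @cts_fun _ _ f x.
  apply: filterS => y /= fxy.
  have -> : l x - l y = (l x - f x) + (f x - f y) + (f y - l y).
    by rewrite !addrA !subrK.
  have := ler_normD (l x - f x + (f x - f y)) (f y - l y).
  have := ler_normD (l x - f x) (f x - f y).
  have := Al f x Af; rewrite distrC; have := Al f y Af.
  lra.
apply/cvg_ex; exists (mkcts lc : C); apply/cvgrPdist_le => e e0.
have [A FA Al] := lE _ e0.
apply: filterS FA => f Af; apply: Cnorm_le => [|x]; first exact: ltW.
by rewrite CaddE CoppE distrC; exact: Al.
Qed.

HB.instance Definition _ := Uniform_isComplete.Build C Cspace_complete.

End Cspace_lmodule.

Definition bounded_operator (K : numFieldType) (V W : normedModType K)
    (f : V -> W) :=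
  exists M : K, forall v, `|f v| <= M * `|v|.

Definition banach_isomorphic (R : realType) (V W : completeNormedModType R) :=
  exists (f : {linear V -> W}) (g : {linear W -> V}),
    [/\ cancel f g, cancel g f, bounded_operator f & bounded_operator g].

(* Main.v *)
Require Import Defs.
From HB Require Import structures.
From mathcomp Require Import finmap.
From mathcomp Require Import all_boot all_order all_algebra.
From mathcomp Require Import all_classical all_reals all_analysis.
From mathcomp Require Import lra.

Set Implicit Arguments.
Unset Strict Implicit.
Unset Printing Implicit Defensive.

Import Order.TTheory GRing.Theory Num.Theory.
Import numFieldNormedType.Exports.

Local Open Scope classical_set_scope.
Local Open Scope card_scope.

(** Let [T] be the set of binary sequences, ordered lexicographically, and [Q]
    the countable set of eventually constant ones.  For a subset [M] of [T]
    containing [Q], let [cut M] be the set of initial segments of [M] that contain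
    the bottom element and not the top one, ordered by inclusion; this line has
    two points for every point of [M], except at the ends.  An ultrafilter on
    [cut M] converges to the set of those [x] in [M] that are in almost all cuts,
    so [cut M] is compact.
    Since [Q] is order dense, [cut M] is separable; its weight is the cardinality
    of [M] ([separable_cut], [weight_cut]).  Embedding [K] and the subsets of [K]
    suitably into [T] yields [2^K] such sets [M] of cardinality [K].

    It remains to see that an isomorphism class of spaces [C(cut M)] has at most
    continuum many members, because [2^K] is larger than the continuum.
    - The indicators [ind R x] of [{I | I x}] span a dense subspace of
      [C(cut M)] ([simple_dense]), so a bounded functional [phi] is determined by
      the function [x |-> phi (ind R x)] on [M].  This function has bounded
      variation, so it is determined by its values on [Q] and at countably many
      other points, and there are at most continuum many bounded functionals
      ([functional_code]).
    - Let [F] be an isomorphism from [C(cut M0)] onto [C(cut M)].  The functionals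
      [f |-> F f I], for the countably many [I] in the canonical dense set indexed
      by [Q], determine [M]: they determine the functions of [C(cut M)] on the
      dense set, and a point outside [Q] is in [M] exactly when one of these
      functions jumps there ([recover_sub], [isomorphic_code]).

    Hence each of the [2^K] spaces is isomorphic to at most continuum many others.
    Cardinal arithmetic then gives [2^K] pairwise nonisomorphic ones
    ([inequivalent_family]); all that is needed is that [P * C] embeds into [P]
    when [C] embeds into [P] and [C * C] into [C] ([embeds_absorb]). *)

(** * Injections and cardinals *)

(** [A] has at most the cardinality of [B]. *)
Definition embeds (A B : Type) := exists f : A -> B, injective f.

Lemma embeds_trans (A B C : Type) : embeds A B -> embeds B C -> embeds A C.
Proof. by move=> [f fi] [g gi]; exists (g \o f); exact: inj_comp. Qed.

Lemma embedsX (A A' B B' : Type) :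
  embeds A B -> embeds A' B' -> embeds (A * A') (B * B').
Proof.
move=> [f fi] [g gi]; exists (fun p => (f p.1, g p.2)).
by move=> [a a'] [b b'] /= [/fi -> /gi ->].
Qed.

Lemma card_setTP (A B : Type) : [set: A] #<= [set: B] <-> embeds A B.
Proof.
split=> [/card_leP[f]|[f fi]].
  exists (fun x => set_val (f (SigSub (mem_set (I : [set: A] x))))).
  move=> x y /val_inj fxy.
  by have /(congr1 val) := inj (mem_setT _) (mem_setT _) fxy.
apply: card_le_trans (card_leT (range f)).
by have /card_eqPle/proj2 := inj_card_eq (A := setT) (in2W fi).
Qed.

(** Any two cardinals are comparable: a maximal partial injection is total or
    onto. *)
Lemma embeds_total (A B : Type) : embeds A B \/ embeds B A.
Proof.
pose P (G : set (A * B)) :=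
  forall p q, G p -> G q -> (p.1 = q.1 <-> p.2 = q.2).
have [F FP Ftot|G [PG maxG]] := @Zorn_bigcup _ P.
  move=> p q [X FX Xp] [Y FY Yq].
  have [XY|YX] := Ftot X Y FX FY.
    by apply: (FP Y FY) => //; exact: XY.
  by apply: (FP X FX) => //; exact: YX.
have [[a aG]|domG] := pselect (exists a, forall b, ~ G (a, b)); last first.
  left; have /choice[f fG] a : exists b, G (a, b).
    by apply: contra_notP domG => na; exists a => b Gab; apply: na; exists b.
  by exists f => x y fxy; apply/(PG _ _ (fG x) (fG y)).
have [[b bG]|ranG] := pselect (exists b, forall a, ~ G (a, b)); last first.
  right; have /choice[f fG] b : exists a, G (a, b).
    by apply: contra_notP ranG => na; exists b => c Gab; apply: na; exists c.
  by exists f => x y fxy; apply/(PG _ _ (fG x) (fG y)).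
exfalso; apply: (maxG (G `|` [set (a, b)])).
  split; first by move=> p Gp; left.
  by move=> GG; apply: (aG b); apply: GG; right.
move=> p q [Gp|->] [Gq|->] //=; first exact: PG.
- case: p Gp => x y Gxy /=; split=> e; exfalso.
    by apply: (aG y); rewrite -e.
  by apply: (bG x); rewrite -e.
- case: q Gq => x y Gxy /=; split=> e; exfalso.
    by apply: (aG y); rewrite e.
  by apply: (bG x); rewrite e.
Qed.

(** An instance of the product rule for infinite cardinals, [P * C <= P] when
    [C <= P] and [C] is its own square.  A maximal family of pairwise disjoint
    copies of [C] covers all of [P] but a set that embeds into [C]; inside each
    copy there is room for [C * C], and for the exceptional set in one of them. *)
Lemma embeds_absorb (C P : Type) (c0 c1 : C) :
  c0 <> c1 -> embeds (C * C) C -> embeds C P -> embeds (P * C) P.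
Proof.
move=> c01 [pr pri] [i ii].
pose F (h : C -> P) := range h.
have [E [ED tE maxE]] :=
  ex_maximal_disjoint_subcollection F [set h | injective h].
pose cov p := exists hc : (C -> P) * C, E hc.1 /\ hc.1 hc.2 = p.
(* By maximality, no copy of [C] avoids the part [cov] covered by [E]. *)
have noh (h : C -> P) : injective h -> ~ (forall c, ~ cov (h c)).
  move=> hi hc; apply: (maxE (E `|` [set h])).
  - split=> [g Eg|Eh]; first by left.
    by apply: (hc c0); exists (h, c0); split => //; apply: Eh; right.
  - by move=> g [/ED|->].
  - move=> f g [Ef|->] [Eg|->] //; first exact: tE.
      by move=> [_ [[c _ <-] [c' _ e]]]; exfalso; apply: (hc c'); exists (f, c).
    by move=> [_ [[c _ <-] [c' _ e]]]; exfalso; apply: (hc c); exists (g, c').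
have [h0 Eh0] : exists h, E h.
  apply: contra_notP (noh i ii) => nE c [[h c'] /= [Eh _]].
  by apply: nE; exists h.
have [r ri] : exists r : P -> C,
    forall p q, ~ cov p -> ~ cov q -> r p = r q -> p = q.
  have [[r ri]|[h hi]] := embeds_total {p : P | ~ cov p} C; last first.
    exfalso; apply: (noh (sval \o h)) => [|c]; last exact: (svalP (h c)).
    by apply: inj_comp hi => -[x px] [y py] /= xy; exact/eq_exist.
  exists (fun p => if pselect (~ cov p) is left H then r (exist _ p H) else c0).
  move=> p q np nq; case: pselect => // Hp; case: pselect => // Hq /ri.
  by move=> /(congr1 sval).
pose loc p := if pselect (cov p) is left H then Some (sval (cid H)) else None.
have locP p : match loc p with
    | Some hc => E hc.1 /\ hc.1 hc.2 = p | None => ~ cov p end.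
  by rewrite /loc; case: pselect => // H; exact: (svalP (cid H)).
(* [c0] and [c1] separate, inside [h0], what is covered from what is not. *)
exists (fun pc => if loc pc.1 is Some hc
  then hc.1 (pr (pr (hc.2, pc.2), c0)) else h0 (pr (pr (r pc.1, pc.2), c1))).
have tEE f g x y : E f -> E g -> f x = g y -> f = g /\ x = y.
  move=> Ef Eg fg; have e : f = g.
    by apply: tE => //; exists (f x); split; [exists x|exists y].
  by rewrite e in fg *; split => //; exact: (ED _ Eg).
move=> [p c] [q c'] /=.
move: (locP p) (locP q); case: (loc p) => [[f a]|]; case: (loc q) => [[g b]|] /=.
- move=> [Ef fp] [Eg gq] /(tEE _ _ _ _ Ef Eg)[fg /pri[/pri[ab ->]]].
  by rewrite -fp -gq fg ab.
- by move=> [Ef fp] _ /(tEE _ _ _ _ Ef Eh0)[_ /pri[_ /c01]].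
- by move=> _ [Ef fp] /(tEE _ _ _ _ Eh0 Ef)[_ /pri[_ /esym/c01]].
- by move=> np nq /(tEE _ _ _ _ Eh0 Eh0)[_ /pri[/pri[/(ri _ _ np nq)-> ->]]].
Qed.

(** If the classes of an equivalence relation embed into [C], and the whole
    type does not, then there are as many classes as elements. *)
Lemma inequivalent_family (X C : Type) (E : X -> X -> Prop) (c0 c1 : C) :
  c0 <> c1 -> embeds (C * C) C ->
  (forall x, E x x) -> (forall x y, E x y -> E y x) ->
  (forall x y z, E x y -> E y z -> E x z) ->
  (forall x, exists f : X -> C,
    forall y z, E x y -> E x z -> f y = f z -> y = z) ->
  ~ embeds X C ->
  exists j : X -> X, forall x y, x <> y -> ~ E (j x) (j y).
Proof.
move=> c01 CC Er Es Et /choice[g gi] XC.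
have [[x0 _]|X0] := pselect (exists x : X, True); last first.
  by exfalso; apply: XC; exists (fun=> c0) => x; exfalso; apply: X0; exists x.
pose pick (S : set X) := if pselect (exists x, S x) is left H
  then sval (cid H) else x0.
pose rep x := pick (E x).
have repE x : E x (rep x).
  rewrite /rep /pick; case: pselect => [H|[]]; last by exists x.
  exact: (svalP (cid H)).
have rep_eq x y : E x y -> rep x = rep y.
  move=> Exy; congr pick; apply/funext => z; apply/propext.
  by split; [move=> /(Et _ _ _ (Es _ _ Exy))|exact: Et].
pose P := {y : X | rep y = y}.
have rP x : rep (rep x) = rep x by apply/esym/rep_eq.
have XPC : embeds X (P * C).
  exists (fun x => (exist _ (rep x) (rP x) : P, g (rep x) x)).
  move=> x y /= [rxy]; rewrite rxy => gxy.
  by apply: (gi (rep y)) => //; apply: Es => //; rewrite -rxy.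
have [PC|CP] := embeds_total P C.
  exfalso; apply: XC; apply: (embeds_trans XPC); apply: embeds_trans CC.
  by apply: embedsX PC _; exists id.
have [j ji] := embeds_trans XPC (embeds_absorb c01 CC CP).
exists (sval \o j) => x y xy; move=> /= /rep_eq.
rewrite (svalP (j x)) (svalP (j y)) => e; apply/xy/ji.
by case: (j x) (j y) e => [u pu] [v pv] /= e; exact/eq_exist.
Qed.

(** * Lines of cuts *)

Section Cuts.
Context {d : Order.disp_t} {T : tbOrderType d}.
Implicit Types (M : set T) (x y z : T).
Local Open Scope order_scope.

(** The initial segments of [M] that contain the bottom element of [T] and not
    the top one.  When both are in [M], this leaves out two isolated points, the
    empty segment and [M], and every point of the line then has a neighborhood
    base of sets [{J | J x /\ ~ J y}]. *)
Definition is_cut M (I : set T) :=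
  [/\ I `<=` M, forall x y, I x -> M y -> y <= x -> I y, I \bot & ~ I \top].

(** The line of cuts of [M], ordered by inclusion, with its order topology. *)
Record cut M := Cut { cutset : set T; _ : `[< is_cut M cutset >] }.
Definition in_cut M (I : cut M) : T -> Prop := cutset I.
Coercion in_cut : cut >-> Funclass.

HB.instance Definition _ M := [isSub for @cutset M].
HB.instance Definition _ M := [Choice of cut M by <:].

Lemma cutP M (I : cut M) : is_cut M (in_cut I).
Proof. by case: I => I /= /asboolP. Qed.

Definition cut_le M (I J : cut M) := `[< in_cut I `<=` in_cut J >].

Lemma cut_le_refl M : reflexive (@cut_le M).
Proof. by move=> I; apply/asboolP. Qed.

Lemma cut_le_anti M : antisymmetric (@cut_le M).
Proof.
by move=> I J /andP[/asboolP IJ /asboolP JI]; apply/val_inj/seteqP.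
Qed.

Lemma cut_le_trans M : transitive (@cut_le M).
Proof.
move=> J I H /asboolP IJ /asboolP JH; apply/asboolP; exact: subset_trans JH.
Qed.

HB.instance Definition _ M := Order.Le_isPOrder.Build (Order.Disp tt tt) (cut M)
  (@cut_le_refl M) (@cut_le_anti M) (@cut_le_trans M).

Lemma cut_ltP M (I J : cut M) : I < J <-> exists2 x, J x & ~ I x.
Proof.
have leE (I' J' : cut M) : (I' <= J') = `[< in_cut I' `<=` in_cut J' >] by [].
split.
  rewrite lt_def => /andP[JI]; rewrite leE => /asboolP IJ.
  apply: contraNP JI => nx; apply/eqP/val_inj/seteqP; split => // x Jx.
  by apply: contra_notP nx => nIx; exists x.
move=> [x Jx nIx]; rewrite lt_def leE; apply/andP; split.
  by apply/eqP => JI; apply: nIx; rewrite -JI.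
apply/asboolP => y Iy; have [IM Id _ _] := cutP I; have [JM Jd _ _] := cutP J.
apply: (Jd _ _ Jx (IM _ Iy)); rewrite leNgt; apply/negP => /ltW xy.
exact/nIx/(Id _ _ Iy (JM _ Jx)).
Qed.

Lemma cut_le_total M : total (<=%O : rel (cut M)).
Proof.
move=> I J; apply/orP; have [IJ|nIJ] := pselect (in_cut I `<=` in_cut J).
  by left; apply/asboolP.
right; apply/ltW/cut_ltP; have /existsNP[x /not_implyP[Ix nJx]] := nIJ.
by exists x.
Qed.

HB.instance Definition _ M :=
  Order.POrder_isTotal.Build (Order.Disp tt tt) (cut M) (@cut_le_total M).

HB.instance Definition _ M :=
  @isSubBaseTopological.Build (cut M) (interval (cut M))
    itv_is_open_unbounded (fun i => [set` i]).

HB.instance Definition _ M :=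
  Order_isNbhs.Build _ (cut M) (@order_nbhs_itv _ (cut M)).


Lemma cut_down M (I : cut M) x y : I x -> M y -> y <= x -> I y.
Proof. by have [_ Id _ _] := cutP I; exact: Id. Qed.

Lemma cut_sub M (I : cut M) : in_cut I `<=` M.
Proof. by have [] := cutP I. Qed.

Lemma cut_bot M (I : cut M) : I \bot.
Proof. by have [] := cutP I. Qed.

Lemma cut_top M (I : cut M) : ~ I \top.
Proof. by have [] := cutP I. Qed.

Lemma cut_lt_mem M (I : cut M) x y : I x -> M y -> ~ I y -> x < y.
Proof.
by move=> Ix My nIy; rewrite ltNge; apply/negP => yx; exact/nIy/(cut_down Ix).
Qed.

(** The greatest cut containing no element of [M] above [x]; the top element has to
    be excluded when it is [x] itself. *)
Lemma is_cut_upto M x : M \bot -> \bot != \top :> T ->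
  is_cut M [set y | M y /\ (y <= x /\ y != \top)].
Proof.
move=> Mb bt; split; first by move=> y [].
- move=> y z [_ [yx yt]] Mz zy; split => //; split; first exact: le_trans zy yx.
  by apply: contraNneq yt => zt; rewrite zt in zy; rewrite -le1x.
- by split => //; rewrite le0x.
- by move=> [_ [_]]; rewrite eqxx.
Qed.

(** The least cut containing every element of [M] below [x]; the bottom element
    has to be added when it is [x] itself. *)
Lemma is_cut_below M x : M \bot -> \bot != \top :> T ->
  is_cut M [set y | M y /\ (y < x \/ y = \bot)].
Proof.
move=> Mb bt; split; first by move=> y [].
- move=> y z [_ [yx|->]] Mz zy; split => //; first by left; exact: le_lt_trans yx.
  by right; apply/eqP; rewrite -lex0.
- by split => //; right.
- move=> [_ [|/esym/eqP]]; last by apply/negP.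
  by rewrite lt1x.
Qed.

(** For [x] and [y] in [M], or [y] the top element, these sets form a base of the
    topology ([open_cutitv], [nbhs_cutitv]). *)
Definition cutitv M x y := [set I : cut M | I x /\ ~ I y].

Section Line.
Variables (M : set T).
Hypotheses (Mbot : M \bot) (Mtop : M \top) (bt : \bot != \top :> T).

Definition cut_upto x : cut M := Cut (asboolT (@is_cut_upto M x Mbot bt)).
Definition cut_below x : cut M := Cut (asboolT (@is_cut_below M x Mbot bt)).

Lemma cut_uptoE x y : M y -> x != \top -> cut_upto x y <-> y <= x.
Proof.
move=> My xt; split=> [[_ [] //]|yx]; split => //; split => //.
by apply: contraNneq xt => yt; rewrite yt in yx; rewrite -le1x.
Qed.

Lemma cut_belowE x y : M y -> x != \bot -> cut_below x y <-> y < x.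
Proof.
move=> My xb; split=> [[_ [//|->]]|yx]; last by split=> //; left.
by rewrite lt0x.
Qed.

End Line.

Lemma open_cut_mem M x : open [set I : cut M | I x].
Proof.
have [->|xb] := eqVneq x \bot.
  rewrite (_ : [set _ | _] = setT); first exact: openT.
  by apply/seteqP; split => // I _; exact: cut_bot.
have [[I0]|none] := pselect (exists I : cut M, I x); last first.
  rewrite (_ : [set _ | _] = set0); first exact: open0.
  by apply/seteqP; split => // I Ix; apply: none; exists I.
move=> I0x; have Mb : M \bot by apply: cut_sub (cut_bot I0).
have Mx : M x := cut_sub I0x.
have bt : \bot != \top :> T.
  by apply/eqP => bt; apply: (@cut_top M I0); rewrite -bt; exact: cut_bot.
rewrite (_ : [set _ | _] = `]cut_below Mb bt x, +oo[%classic).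
  exact: rray_open.
apply/seteqP; split => I /=; rewrite in_itv/= andbT.
  by move=> Ix; apply/cut_ltP; exists x => //; rewrite cut_belowE// ltxx.
move=> /cut_ltP[y Iy nby]; apply: (cut_down Iy Mx).
rewrite leNgt; apply/negP => yx; apply/nby/cut_belowE => //.
exact: cut_sub Iy.
Qed.

Lemma open_cut_notin M x : open [set I : cut M | ~ I x].
Proof.
have [->|xt] := eqVneq x \top.
  rewrite (_ : [set _ | _] = setT); first exact: openT.
  by apply/seteqP; split => // I _; exact: cut_top.
have [[I0]|none] := pselect (exists I : cut M, I x); last first.
  rewrite (_ : [set _ | _] = setT); first exact: openT.
  by apply/seteqP; split => // I _ Ix; apply: none; exists I.
move=> I0x; have Mb : M \bot by apply: cut_sub (cut_bot I0).
have Mx : M x := cut_sub I0x.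
have bt : \bot != \top :> T.
  by apply/eqP => bt; apply: (@cut_top M I0); rewrite -bt; exact: cut_bot.
rewrite (_ : [set _ | _] = `]-oo, cut_upto Mb bt x[%classic).
  exact: lray_open.
apply/seteqP; split => I /=; rewrite in_itv/=.
  by move=> Ix; apply/cut_ltP; exists x => //; rewrite cut_uptoE.
move=> /cut_ltP[y /[dup] /cut_sub My + nIy Ix]; rewrite cut_uptoE// => yx.
exact/nIy/(cut_down Ix).
Qed.

Lemma open_cutitv M x y : open (@cutitv M x y).
Proof. exact: openI (open_cut_mem M x) (open_cut_notin M y). Qed.

Lemma cutitv_subset M x y x' y' : x' <= x -> y <= y' -> M x' -> M y ->
  @cutitv M x y `<=` cutitv x' y'.
Proof.
move=> x'x yy' Mx' My I [Ix nIy]; split; first exact: (cut_down Ix).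
by move=> Iy'; exact/nIy/(cut_down Iy').
Qed.

Lemma nbhs_cutitv M (I : cut M) (U : set (cut M)) : nbhs I U ->
  exists x y, [/\ M x, M y \/ y = \top, cutitv x y I & cutitv x y `<=` U].
Proof.
rewrite itv_nbhsE => -[[l r] [io]].
rewrite itv_boundlr => /andP[lI Ir] iU.
have [x [Ix lx]] : exists x, I x /\ forall J : cut M, J x -> (l <= BLeft J)%O.
  case: l io lI {iU} => [[] a|[]] //=; rewrite ?bnd_simp => io.
  - move=> /cut_ltP[x Ix nax]; exists x; split => // J Jx.
    by rewrite bnd_simp; apply/cut_ltP; exists x.
  - by exists \bot; split => //; exact: cut_bot.
have [y [My nIy ry]] :
    exists y, [/\ M y \/ y = \top, ~ I y &
      forall J : cut M, ~ J y -> (BRight J <= r)%O].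
  case: r io Ir {iU} => [[] b|[]] //=; rewrite ?bnd_simp => io.
  - move=> /cut_ltP[y by_ nIy]; exists y; split => //.
      by left; exact: cut_sub by_.
    by move=> J nJy; rewrite bnd_simp; apply/cut_ltP; exists y.
  - by move: io {lI lx}; case: l => [[] a|[]].
  - by exists \top; split => //; [right|exact: cut_top].
exists x, y; split => //; first exact: cut_sub Ix.
by move=> J [Jx nJy]; apply: iU; rewrite /= itv_boundlr lx// ry.
Qed.

Lemma compact_cut M : compact [set: cut M].
Proof.
rewrite compact_ultra => F FU _.
(* The limit of the ultrafilter [F]. *)
pose I := [set x | M x /\ F [set J : cut M | J x]].
have IP : is_cut M I.
  split; first by move=> x [].
  - move=> x y [Mx Fx] My yx; split => //; apply: filterS Fx => J Jx.
    exact: (cut_down Jx).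
  - split; last by apply: filterS filterT => J _; exact: cut_bot.
    by have [J _] := filter_ex (filterT : F setT); exact: cut_sub (cut_bot J).
  - move=> [_] /filter_ex[J]; exact: cut_top.
pose I' : cut M := Cut (asboolT IP).
exists I'; split => // U /nbhs_cutitv[x [y [_ _ [[_ Fx] nIy] sU]]].
apply: filterS sU _; apply: filterI => //.
have [Fy|//] := in_ultra_setVsetC [set J : cut M | J y] FU.
by case: nIy; split => //; have [J Jy] := filter_ex Fy; exact: cut_sub Jy.
Qed.


HB.instance Definition _ (M : set T) :=
  Topological_isCompact.Build (cut M) (@compact_cut M).

End Cuts.

Lemma embeds_countType (A : countType) : embeds A nat.
Proof. by exists pickle; exact: pcan_inj pickleK. Qed.

(** * Separability and weight of a line of cuts *)

Section Weight.
Context {d : Order.disp_t} {T : tbOrderType d}.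
Implicit Types (x y z : T).
Local Open Scope order_scope.

(** [Q] contains both ends of [T] and meets every nonempty interval [[x, y)]. *)
Definition fills (Q : set T) :=
  [/\ Q \bot, Q \top & forall x y, x < y -> exists q, [/\ Q q, x <= q & q < y]].

Lemma cutitv_lt (M : set T) (I : cut M) x y :
  M y \/ y = \top -> cutitv x y I -> x < y.
Proof.
move=> [My|->] [Ix nIy]; first exact: cut_lt_mem Ix My nIy.
by rewrite ltx1; apply/eqP => xt; apply: (@cut_top _ _ M I); rewrite -xt.
Qed.

Variables (Q M : set T).
Hypotheses (Qfill : fills Q) (QM : Q `<=` M) (bt : \bot != \top :> T).

Let Mbot : M \bot. Proof. by apply: QM; have [] := Qfill. Qed.

Lemma fills_neq x : ~ Q x -> x != \bot /\ x != \top.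
Proof.
by have [Qb Qt _] := Qfill => nQ; split; apply/eqP => xE; apply: nQ; rewrite xE.
Qed.

Lemma dense_cut_upto : dense (range (fun q : Q => cut_upto Mbot bt (val q))).
Proof.
have [_ _ Qd] := Qfill.
move=> O [I OI] oO; have [x [y [Mx My xyI xyO]]] :=
  nbhs_cutitv (open_nbhs_nbhs (conj oO OI)).
have [q [Qq xq qy]] := Qd _ _ (cutitv_lt My xyI).
have qt : q != \top by apply: contraTneq qy => ->; rewrite -leNgt lex1.
exists (cut_upto Mbot bt q); split.
  apply: xyO; split; first exact/cut_uptoE.
  case: My => [My|->]; last exact: cut_top.
  by rewrite cut_uptoE// => yq; have := le_lt_trans yq qy; rewrite ltxx.
by exists (SigSub (mem_set Qq)).
Qed.

Lemma separable_cut : countable Q -> separable_space (cut M).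
Proof.
move=> Qc; eexists; last exact: dense_cut_upto.
apply: sub_countable (card_image_le _ _) _.
by apply: sub_countable Qc; have /card_eqPle[] := card_setT Q.
Qed.

(** The cut just below a point [x] of [M] is the last one without [x]; so a basic
    open set around it without cuts containing [x] determines [x]. *)
Lemma card_le_basis (K : Type) (f : K -> T) (B : set (set (cut M))) :
  injective f -> (forall k, M (f k) /\ f k != \bot) -> basis B -> [set: K] #<= B.
Proof.
move=> fi fM [Bo Bn].
have /choice[g gP] k : exists U, [/\ B U, U (cut_below Mbot bt (f k)) &
    U `<=` [set J | ~ J (f k)]].
  have [Mk kb] := fM k.
  have [|U [BU Uk] Us] := Bn (cut_below Mbot bt (f k)) [set J | ~ J (f k)].
    apply: open_nbhs_nbhs; split; first exact: open_cut_notin.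
    by move/(cut_belowE Mbot bt Mk kb); rewrite ltxx.
  by exists U.
have gi : injective g.
  have gle k l : g k = g l -> f k <= f l.
    move=> e; have [_ gk _] := gP k; have [_ _ gl] := gP l.
    rewrite leNgt; apply/negP => lk; rewrite e in gk; apply: (gl _ gk).
    by apply/cut_belowE => //; [exact: (fM l).1|exact: (fM k).2].
  by move=> k l e; apply/fi/le_anti; rewrite !gle.
apply: card_le_trans (_ : [set: K] #<= range g) _.
  by have /card_eqPle/proj2 := inj_card_eq (A := setT) (in2W gi).
by apply: subset_card_le => _ [k _ <-]; have [] := gP k.
Qed.

(** The sets [cutitv x y] with [x] or [y] in [Q] already form a base, hence no
    squaring of [K] is needed for the upper bound. *)
Lemma weight_cut (K : Type) (f : K -> T) (e : K * nat -> T) (qq : nat -> T) :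
  embeds (K * nat) K -> injective f -> (forall k, M (f k) /\ f k != \bot) ->
  M `<=` range e -> Q `<=` range qq -> has_weight (cut M) K.
Proof.
have [Qb Qt Qd] := Qfill.
move=> KnK fi fM Me Qqq.
have low (B : set (set (cut M))) : basis B -> [set: K] #<= B.
  exact: card_le_basis fi fM.
split; last exact: low.
pose F (i : (K * nat) * (nat * bool)) : set (cut M) :=
  if i.2.2 then cutitv (e i.1) (qq i.2.1) else cutitv (qq i.2.1) (e i.1).
have FB : basis (range F).
  split; first by move=> _ [[a [n []]] _ <-]; exact: open_cutitv.
  move=> I U /nbhs_cutitv[x [y [Mx My xyI xyU]]].
  have xy := cutitv_lt My xyI.
  have {}My : M y by case: My => // ->; exact: QM.
  have [q [Qq xq qy]] := Qd _ _ xy.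
  have [[[a _ ax] [b _ by_]] [n _ nq]] := (Me _ Mx, Me _ My, Qqq _ Qq).
  move: xyI => [Ix nIy].
  have [Iq|nIq] := pselect (I q).
    exists (cutitv q y); last first.
      by apply: subset_trans xyU; apply: cutitv_subset.
    by split => //; exists (b, (n, false)) => //; rewrite /F/= nq by_.
  exists (cutitv x q); last first.
    apply: subset_trans xyU; apply: cutitv_subset => //; [exact: ltW|exact: QM].
  by split => //; exists (a, (n, true)) => //; rewrite /F/= nq ax.
exists (range F) => //; apply/card_eqPle; split; last exact: low.
apply: card_le_trans (card_image_le _ _) _; apply/card_setTP.
apply: (embeds_trans _ KnK); apply: embedsX KnK _.
exact: embeds_countType.
Qed.

End Weight.

(** * Continuous functions on a line of cuts *)

Section Simple.
Context {R : realType} {d : Order.disp_t} {T : tbOrderType d}.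
Variable M : set T.
Local Notation C := (Cspace R (cut M)).
Implicit Types (x y z : T) (I J : cut M) (f g h : C).
Local Open Scope ring_scope.

Lemma ind_subproof x : continuous (fun I : cut M => (`[< I x >])%:R : R).
Proof.
move=> I; apply/(cvgrPdist_lt (FF := nbhs_filter I)) => e e0.
have [Ix|nIx] := pselect (I x).
  apply: (@filterS _ _ (nbhs_filter I) [set J : cut M | J x]) => [J Jx|].
    by rewrite /= (asboolT Ix) (asboolT Jx) subrr normr0.
  by apply: open_nbhs_nbhs; split; first exact: open_cut_mem.
apply: (@filterS _ _ (nbhs_filter I) [set J : cut M | ~ J x]) => [J nJx|].
  by rewrite /= (asboolF nIx) (asboolF nJx) subrr normr0.
by apply: open_nbhs_nbhs; split; first exact: open_cut_notin.
Qed.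

(** The indicator of the cuts that contain [x]; it is [1] for [x = \bot]. *)
Definition ind x : C := mkcts (@ind_subproof x).

Lemma indE x I : ind x I = (`[< I x >])%:R.
Proof. by []. Qed.

Lemma ind1 x I : I x -> ind x I = 1.
Proof. by move=> Ix; rewrite indE (asboolT Ix). Qed.

Lemma ind0 x I : ~ I x -> ind x I = 0.
Proof. by move=> Ix; rewrite indE (asboolF Ix). Qed.

(** The linear span of the indicators. *)
Inductive simple : C -> Prop :=
| simple_base x : simple (ind x)
| simple_lin a f g : simple f -> simple g -> simple (a *: f + g).

Lemma simple0 : simple 0.
Proof.
rewrite -(addNr (ind \bot%O)) -scaleN1r.
exact: simple_lin (simple_base _) (simple_base _).
Qed.

Lemma simpleZ a f : simple f -> simple (a *: f).
Proof. by move=> sf; rewrite -[_ *: _]addr0; apply: simple_lin sf simple0. Qed.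

Lemma simpleD f g : simple f -> simple g -> simple (f + g).
Proof. by rewrite -[f in f + _]scale1r; exact: simple_lin. Qed.

Lemma simpleB f g : simple f -> simple g -> simple (f - g).
Proof. by move=> sf sg; rewrite addrC -scaleN1r; exact: simple_lin. Qed.

Lemma simple_mul f g : simple f -> simple g ->
  exists2 h, simple h & forall I, h I = f I * g I.
Proof.
move=> sf sg; elim: sf => [x|a f1 f2 _ [h1 s1 h1E] _ [h2 s2 h2E]]; last first.
  exists (a *: h1 + h2); first exact: simple_lin.
  by move=> I; rewrite !CaddE !CscaleE h1E h2E mulrDl mulrA.
elim: sg => [y|a f1 f2 _ [h1 s1 h1E] _ [h2 s2 h2E]]; last first.
  exists (a *: h1 + h2); first exact: simple_lin.
  by move=> I; rewrite !CaddE !CscaleE h1E h2E mulrDr mulrCA.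
wlog xy : x y / (x <= y)%O => [wl|].
  have /orP[/wl//|/wl[h sh hE]] := le_total x y.
  by exists h => // I; rewrite hE mulrC.
have [Mx|nMx] := pselect (M x).
  exists (ind y) => [|I]; first exact: simple_base.
  have [Iy|nIy] := pselect (I y); last by rewrite (ind0 nIy) mulr0.
  by rewrite (ind1 Iy) (ind1 (cut_down Iy Mx xy)) mulr1.
exists (ind x) => [|I]; first exact: simple_base.
by rewrite ind0 ?mul0r// => /cut_sub.
Qed.

(** Local approximations on the sets [cutitv x y] are patched together by
    compactness. *)
Lemma simple_dense f (e : R) : 0 < e ->
  exists2 g, simple g & forall I, `|f I - g I| <= e.
Proof.
move=> e0.
(* [u] is the indicator of a set containing [U], on which [g] approximates [f],
   while [g] vanishes elsewhere. *)
pose good (U : set (cut M)) := exists u g, [/\ simple u, simple g,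
  forall I, U I -> u I = 1 &
  forall I, (u I = 1 /\ `|f I - g I| <= e) \/ (u I = 0 /\ g I = 0)].
have [[u [g [_ sg u1 ug]]]|ngood] := pselect (good setT).
  exists g => // I; have [[_ //]|[]] := ug I.
  by rewrite u1// => /eqP; rewrite oner_eq0.
exfalso; pose F := [set W : set (cut M) | good (~` W)].
have FF : ProperFilter F.
  split; first by rewrite /F/= setC0.
  split.
  - rewrite /F/= setCT; exists 0, 0; split => //; try exact: simple0.
    by move=> I; right.
  - move=> U V [u1 [g1 [su1 sg1 U1 ug1]]] [u2 [g2 [su2 sg2 U2 ug2]]].
    have [uu suu uuE] := simple_mul su1 su2.
    have [ug sug ugE] := simple_mul su1 sg2.
    exists (u1 + (u2 - uu)), (g1 + (g2 - ug)).
    have aux I : (u1 + (u2 - uu)) I = u1 I + (u2 I - u1 I * u2 I).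
      by rewrite !CaddE !CoppE uuE.
    have auxg I : (g1 + (g2 - ug)) I = g1 I + (g2 I - u1 I * g2 I).
      by rewrite !CaddE !CoppE ugE.
    split.
    - exact: simpleD su1 (simpleB su2 suu).
    - exact: simpleD sg1 (simpleB sg2 sug).
    - move=> I; rewrite setCI aux => -[/U1 ->|/U2 ->].
        by rewrite mul1r subrr addr0.
      by rewrite mulr1 subrKC.
    - move=> I; rewrite aux auxg; have [[-> ?]|[-> ->]] := ug1 I.
        by left; rewrite !mul1r !subrr !addr0.
      by rewrite !mul0r !subr0 !add0r; exact: ug2.
  - move=> U V UV [u [g [su sg U1 ug]]]; exists u, g; split => // I VI.
    by apply: U1 => /UV.
have [I [_ cI]] := @compact_setT (cut M) F FF filterT.
have /(cvgrPdist_lt (FF := nbhs_filter I))/(_ _ e0)/nbhs_cutitv :=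
  @cts_fun _ _ f I.
move=> [x [y [_ _ xyI xyU]]].
have : F (~` cutitv x y).
  have [uu suu uuE] := simple_mul (simple_base x) (simple_base y).
  pose u := ind x - uu.
  have su : simple u by apply: simpleB => //; exact: simple_base.
  have u1 J : cutitv x y J -> u J = 1.
    by move=> [Jx nJy]; rewrite /u CaddE CoppE uuE (ind1 Jx) (ind0 nJy) mulr0 subr0.
  have u0 J : ~ cutitv x y J -> u J = 0.
    move=> nJ; rewrite /u CaddE CoppE uuE.
    have [Jx|nJx] := pselect (J x); last by rewrite (ind0 nJx) mul0r subrr.
    have [Jy|nJy] := pselect (J y); last by exfalso; apply: nJ.
    by rewrite (ind1 Jx) (ind1 Jy) mulr1 subrr.
  rewrite /F/= setCK; exists u, (f I *: u); split => // [|J]; first exact: simpleZ.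
  have [xyJ|nxyJ] := pselect (cutitv x y J); rewrite CscaleE.
    left; rewrite u1// mulr1; split => //.
    by rewrite distrC ltW//; exact: xyU.
  by right; rewrite u0// mulr0.
move=> FA; have [|J [nJ Jxy]] := cI _ (cutitv x y) FA; last exact: nJ Jxy.
by apply: open_nbhs_nbhs; split; first exact: open_cutitv.
Qed.

(** Bounded linear functionals, as plain functions. *)
Definition functional (phi : C -> R) :=
  (forall a f g, phi (a *: f + g) = a * phi f + phi g) /\
  exists2 N : R, 0 <= N & forall f, `|phi f| <= N * `|f|.

Lemma functional0 phi : functional phi -> phi 0 = 0.
Proof.
move=> [phiL _]; have := phiL (-1) 0 0.
by rewrite scaler0 addr0 mulN1r addNr.
Qed.

Lemma functionalB phi f g : functional phi -> phi (f - g) = phi f - phi g.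
Proof.
by move=> [phiL _]; rewrite addrC -scaleN1r phiL mulN1r addrC.
Qed.

Lemma functional_ext phi psi : functional phi -> functional psi ->
  (forall x, phi (ind x) = psi (ind x)) -> forall f, phi f = psi f.
Proof.
move=> Fphi Fpsi eq_ind f.
have eq_simple g : simple g -> phi g = psi g.
  elim=> // a f1 f2 _ IH1 _ IH2.
  by rewrite (proj1 Fphi) (proj1 Fpsi) IH1 IH2.
have [[_ [N N0 phiN]] [_ [N' N'0 psiN]]] := (Fphi, Fpsi).
apply/eqP; rewrite -subr_eq0 -normr_le0; apply/ler_addgt0Pr => e e0; rewrite add0r.
have NN : 0 < N + N' + 1 by rewrite ltr_wpDl// addr_ge0.
have [|g sg fg] := @simple_dense f (e / (N + N' + 1)); first exact: divr_gt0.
have -> : phi f - psi f = phi (f - g) - psi (f - g).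
  rewrite (functionalB f g Fphi) (functionalB f g Fpsi) (eq_simple g)//.
  by rewrite opprB addrA subrK.
have le_fg : `|f - g| <= e / (N + N' + 1).
  by apply: Cnorm_le => [|I]; [rewrite divr_ge0// ltW|exact: fg].
rewrite (le_trans (ler_normB _ _))//.
rewrite (le_trans (lerD (phiN _) (psiN _)))// -mulrDl.
rewrite (le_trans (ler_wpM2l (addr_ge0 N0 N'0) le_fg))//.
rewrite mulrA ler_pdivrMr// mulrC ler_pM2l// lerDl//.
Qed.

End Simple.
Arguments ind R {d T M} x.

(** * Counting bounded functionals *)

(** A type of the cardinality of the continuum. *)
Definition bits := nat -> bool.

Lemma embeds_seq_bits : embeds (nat -> bits) bits.
Proof.
exists (fun s n =>
  if (unpickle n : option (nat * nat)) is Some ij then s ij.1 ij.2 else false).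
move=> s t st; apply/funext => i; apply/funext => j.
by have /(congr1 (@^~ (pickle (i, j)))) := st; rewrite !pickleK.
Qed.

Lemma embeds_pair_bits : embeds (bits * bits) bits.
Proof.
apply: embeds_trans embeds_seq_bits.
exists (fun p n => if n is 0%N then p.1 else p.2) => -[a b] [c e] abce.
by have [/(congr1 (@^~ 0%N))/= -> /(congr1 (@^~ 1%N))/= ->] := (abce, abce).
Qed.

Lemma embeds_funr (A B C : Type) : embeds B C -> embeds (A -> B) (A -> C).
Proof.
move=> [f fi]; exists (fun u => f \o u) => u v uv; apply/funext => a.
by apply: fi; exact: (congr1 (@^~ a) uv).
Qed.

(** A real number is determined by the rational numbers below it. *)
Lemma embeds_real_bits (R : realType) : embeds R bits.
Proof.
pose f (x : R) : bits :=
  fun n => if (unpickle n : option rat) is Some q then (ratr q < x)%R else false.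
have flt (x y : R) : (x < y)%R -> f x <> f y.
  move=> /rat_in_itvoo[q]; rewrite in_itv/= => /andP[xq qy].
  move=> /(congr1 (@^~ (pickle q))); rewrite /f pickleK qy.
  by rewrite ltNge (ltW xq).
exists f => x y fxy; apply/eqP; rewrite eq_le !leNgt.
by apply/andP; split; apply/negP => /flt; apply.
Qed.

Lemma countable_sub_range (A : Type) (a0 : A) (S : set A) : countable S ->
  exists s : nat -> A, S `<=` range s.
Proof.
move=> /countable_injP[f fi].
have /choice[s sP] n : exists a, forall b, S b -> f b = n -> b = a.
  have [[a [Sa fa]]|none] := pselect (exists a, S a /\ f a = n).
    by exists a => b Sb fb; apply: fi; rewrite ?inE// fb.
  by exists a0 => b Sb fb; exfalso; apply: none; exists b.
by exists s => a Sa; exists (f a) => //; apply/esym/sP.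
Qed.

Section Functionals.
Context {R : realType} {d : Order.disp_t} {T : tbOrderType d}.
Variables (Q M : set T).
Hypotheses (Qfill : fills Q) (QM : Q `<=` M).
Local Notation C := (Cspace R (cut M)).
Implicit Types (x y z m q : T) (I J : cut M) (f g h : C) (phi : C -> R).
Local Open Scope ring_scope.

(** The points [m] of [M] outside [Q] such that, for [q] in [Q] arbitrarily close
    to [m] from below, [phi (ind R q)] differs from [phi (ind R m)] by more than
    [1 / (k + 1)]. *)
Definition jumps phi k := [set m | [/\ M m, ~ Q m &
  forall x, M x -> (x < m)%O -> exists q, [/\ Q q, (x <= q)%O, (q < m)%O &
    k.+1%:R^-1 < `|phi (ind R q) - phi (ind R m)|]]].

(** For each jump [m] in [s] there is [q] in [Q] between the previous point and [m]
    such that [phi] is large on [ind R q - ind R m], up to sign.  These functions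
    are indicators of disjoint sets, so their signed sum is bounded by one. *)
Lemma jumps_sum phi k x (s : seq T) : functional phi -> M x ->
  path <%O x s -> (forall m, m \in s -> jumps phi k m) ->
  exists f, [/\ forall I, `|f I| <= 1, forall I, ~ I x -> f I = 0 &
    (size s)%:R * k.+1%:R^-1 <= phi f].
Proof.
move=> Fphi; elim: s x => [|m s IH] x Mx /=.
  exists 0; split => [I|//|]; first by rewrite CzeroE normr0.
  by rewrite mul0r functional0.
move=> /andP[xm ms] sJ; have [Mm nQm Jm] := sJ m (mem_head _ _).
have [|f [f1 f0 fphi]] := IH m Mm ms.
  by move=> m' m's; apply: sJ; rewrite inE m's orbT.
have [q [Qq xq qm qJ]] := Jm x Mx xm.
pose c : R := Num.sg (phi (ind R q) - phi (ind R m)).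
have c1 : `|c| <= 1 by rewrite normr_sg; case: (_ != 0).
exists (c *: (ind R q - ind R m) + f).
have [phiL _] := Fphi; split => [I|I nIx|].
- rewrite CaddE CscaleE CaddE CoppE.
  have [Im|nIm] := pselect (I m).
    rewrite (ind1 Im) (ind1 (cut_down Im (QM Qq) (ltW qm))) subrr mulr0 add0r.
    exact: f1.
  rewrite (f0 _ nIm) (ind0 nIm) subr0 addr0 normrM.
  have [Iq|nIq] := pselect (I q); first by rewrite (ind1 Iq) normr1 mulr1.
  by rewrite (ind0 nIq) normr0 mulr0.
- have nIq : ~ I q by move=> Iq; apply: nIx; exact: cut_down Iq Mx xq.
  have nIm : ~ I m by move=> Im; apply: nIx; apply: (cut_down Im Mx); exact: ltW.
  rewrite CaddE CscaleE CaddE CoppE (f0 _ nIm) (ind0 nIm) (ind0 nIq).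
  by rewrite subrr mulr0 addr0.
rewrite phiL (functionalB _ _ Fphi) -normrEsg -natr1 mulrDl mul1r addrC.
by rewrite lerD// ltW.
Qed.

Lemma finite_jumps phi k : functional phi -> finite_set (jumps phi k).
Proof.
move=> Fphi; have [phiL [N N0 phiN]] := Fphi.
apply: contrapT => /(infinite_set_fset (Num.bound (N * k.+1%:R)))[B BJ nB].
have [Qb _ _] := Qfill.
pose s := sort <=%O (enum_fset B).
have sB m : (m \in s) = (m \in B) by rewrite mem_sort.
have sp : path <%O (\bot%O) s.
  rewrite path_min_sorted; first by rewrite sort_lt_sorted fset_uniq.
  apply/allP => m; rewrite sB => /BJ[_ nQm _].
  by rewrite lt0x; apply/eqP => mb; apply: nQm; rewrite mb.
have [|f [f1 _ fphi]] := jumps_sum (k := k) Fphi (QM Qb) sp.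
  by move=> m; rewrite sB => /BJ.
have le1 : `|f| <= 1 by exact: Cnorm_le.
have fN : N * `|f| <= N by rewrite ler_piMr.
have := le_trans fphi (le_trans (ler_norm _) (le_trans (phiN f) fN)).
rewrite ler_pdivrMr// size_sort leNgt => /negP; apply.
by apply: (lt_le_trans (archi_boundP _)); rewrite ?mulr_ge0// ler_nat.
Qed.

Lemma countable_jumps phi : functional phi ->
  countable (\bigcup_(k in [set: nat]) jumps phi k).
Proof.
move=> Fphi; apply: bigcup_countable => // k _.
exact/finite_set_countable/finite_jumps.
Qed.

Lemma functional_eq_jumps phi psi : functional phi -> functional psi ->
  (forall q, Q q -> phi (ind R q) = psi (ind R q)) ->
  (forall k m, jumps phi k m \/ jumps psi k m -> phi (ind R m) = psi (ind R m)) ->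
  forall f, phi f = psi f.
Proof.
move=> Fphi Fpsi eqQ eqJ; apply: functional_ext => // m.
have [Qm|nQm] := pselect (Q m); first exact: eqQ.
have [Mm|nMm] := pselect (M m); last first.
  suff -> : ind R m = 0 :> C by rewrite !functional0.
  by apply: CspaceP => I; rewrite ind0// => /cut_sub.
have [[k Jk]|nJ] := pselect (exists k, jumps phi k m \/ jumps psi k m).
  exact: (eqJ k).
have near_left xi k : ~ jumps xi k m -> exists x, [/\ M x, (x < m)%O &
    forall q, Q q -> (x <= q)%O -> (q < m)%O ->
      `|xi (ind R q) - xi (ind R m)| <= k.+1%:R^-1].
  move=> nJk; apply: contrapT => nx; apply: nJk; split => // x Mx xm.
  apply: contrapT => nq; apply: nx; exists x; split => // q Qq xq qm.
  by rewrite leNgt; apply/negP => qJ; apply: nq; exists q.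
suff small (e : R) : 0 < e -> `|phi (ind R m) - psi (ind R m)| <= e.
  apply/eqP; rewrite -subr_eq0 -normr_le0; apply/ler_addgt0Pr => e /small.
  by rewrite add0r.
move=> e0; have [k ke] : exists k, k.+1%:R^-1 < e / 2 :> R.
  have e2 : 0 < e / 2 by rewrite divr_gt0.
  exists (Num.bound (e / 2)^-1); rewrite -[ltRHS]invrK ltf_pV2 ?posrE ?invr_gt0//.
  apply: (lt_le_trans (archi_boundP _)); first by rewrite invr_ge0 ltW.
  by rewrite ler_nat.
have [|x [Mx xm xphi]] := near_left phi k.
  by move=> Jk; apply: nJ; exists k; left.
have [|y [My ym ypsi]] := near_left psi k.
  by move=> Jk; apply: nJ; exists k; right.
have [_ _ Qd] := Qfill.
have [|q [Qq xyq qm]] := Qd (Order.max x y) m; first by rewrite gt_max xm ym.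
move: xyq; rewrite ge_max => /andP[xq yq].
have := xphi q Qq xq qm; have := ypsi q Qq yq qm; rewrite (eqQ q)//.
move: ke; rewrite !ler_norml.
move: (phi (ind R m)) (psi (ind R m)) (psi (ind R q)) (k.+1%:R^-1) => a b c K.
by move=> ? /andP[? ?] /andP[? ?]; apply/andP; split; lra.
Qed.

(** The values on [Q], and the list of jumps with the values there, determine a
    bounded functional; hence there are at most continuum many of them. *)
Lemma functional_code (qq : nat -> T) : Q `<=` range qq -> embeds T bits ->
  exists code : (C -> R) -> bits, forall phi psi,
    functional phi -> functional psi -> code phi = code psi ->
    forall f, phi f = psi f.
Proof.
move=> Qqq Tb.
have /choice[s sP] phi : exists s : nat -> T,
    functional phi -> forall k, jumps phi k `<=` range s.
  have [Fphi|nF] := pselect (functional phi); last by exists (fun=> \bot%O).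
  have [s sP] := countable_sub_range (\bot%O : T) (countable_jumps Fphi).
  by exists s => _ k m Jm; apply: sP; exists k.
have [cT cTi] := embeds_trans (@embeds_funr nat _ _ Tb) embeds_seq_bits.
have [cR cRi] :=
  embeds_trans (@embeds_funr nat _ _ (embeds_real_bits R)) embeds_seq_bits.
have [pr pri] := embeds_pair_bits.
exists (fun phi => pr (cR (fun n => phi (ind R (qq n))),
  pr (cT (s phi), cR (fun n => phi (ind R (s phi n)))))).
move=> phi psi Fphi Fpsi /pri[/cRi eqQ /pri[/cTi eqs /cRi eqv]].
apply: functional_eq_jumps => // [q /Qqq[n _ <-]|k m Jm].
  exact: (congr1 (@^~ n) eqQ).
have [n _ <-] : range (s phi) m.
  by case: Jm => [|Jm]; [exact: sP|rewrite eqs; exact: sP Jm].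
by have /(congr1 (@^~ n)) := eqv; rewrite -eqs.
Qed.

End Functionals.

(** * Isomorphisms *)

Section Isomorphisms.
Local Open Scope ring_scope.

Lemma banach_isomorphic_refl (R : realType) (V : completeNormedModType R) :
  banach_isomorphic V V.
Proof.
exists idfun, idfun; split => //; exists 1 => v; by rewrite mul1r.
Qed.

Lemma banach_isomorphic_sym (R : realType) (V W : completeNormedModType R) :
  banach_isomorphic V W -> banach_isomorphic W V.
Proof. by move=> [f [g [fK gK fb gb]]]; exists g, f. Qed.

Lemma bounded_operator_comp (R : realType) (U V W : normedModType R)
    (f : U -> V) (g : V -> W) :
  bounded_operator f -> bounded_operator g -> bounded_operator (g \o f).
Proof.
move=> [N fN] [N' gN']; exists (`|N'| * N) => u /=.
apply: le_trans (gN' _) _.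
apply: le_trans (ler_wpM2r (normr_ge0 _) (ler_norm N')) _.
by rewrite -mulrA ler_wpM2l.
Qed.

Lemma banach_isomorphic_trans (R : realType) (U V W : completeNormedModType R) :
  banach_isomorphic U V -> banach_isomorphic V W -> banach_isomorphic U W.
Proof.
move=> [f [f' [fK f'K fb f'b]]] [g [g' [gK g'K gb g'b]]].
exists (g \o f), (f' \o g'); split; [exact: can_comp|exact: can_comp| |].
  exact: bounded_operator_comp.
exact: bounded_operator_comp.
Qed.

End Isomorphisms.

Section Recover.
Context {R : realType} {d : Order.disp_t} {T : tbOrderType d}.
Variables (Q : set T).
Hypotheses (Qfill : fills Q) (bt : \bot%O != \top%O :> T).
Implicit Types (x y m q : T) (M : set T).
Local Open Scope ring_scope.

Let Qbot M : Q `<=` M -> M \bot%O.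
Proof. by have [Qb _ _] := Qfill => QM; exact: QM. Qed.

(** In [cut M], a point [m] outside [M] gives a single cut, which is approached
    from both sides by cuts [cut_upto q] with [q] in [Q]; so no continuous function
    jumps there. *)
Lemma continuous_no_jump M (Mb : M \bot%O) m (h : Cspace R (cut M)) :
  ~ Q m -> ~ M m ->
  ~ (forall q, Q q -> q != \top%O -> h (cut_upto Mb bt q) = (m <= q)%O%:R).
Proof.
move=> nQm nMm hE; have [Qb Qt Qd] := Qfill.
have [mb mt] := fills_neq Qfill nQm.
pose I := cut_below Mb bt m.
have e2 : (0 : R) < 1 / 2 by rewrite divr_gt0.
have /(cvgrPdist_lt (FF := nbhs_filter I))/(_ _ e2)/nbhs_cutitv :=
  @cts_fun _ _ h I.
move=> [x [y [Mx My [Ix nIy] xyI]]].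
have xm : (x < m)%O by move/(cut_belowE Mb bt Mx mb): Ix.
have my : (m < y)%O.
  case: My nIy => [My nIy|-> _]; last by rewrite ltx1.
  rewrite lt_neqAle; apply/andP; split; first by apply: contra_notN nMm => /eqP ->.
  by rewrite leNgt; apply: contra_notN nIy => ym; apply/cut_belowE.
have near q : (x <= q)%O -> (q < y)%O -> `|h I - h (cut_upto Mb bt q)| < 1 / 2.
  move=> xq qy; have qt : q != \top%O.
    by apply: contraTneq qy => ->; rewrite -leNgt lex1.
  apply: xyI; split; first exact/cut_uptoE.
  case: My => [My|->]; last exact: cut_top.
  by move/(cut_uptoE Mb bt My qt); rewrite leNgt qy.
have [q [Qq xq qm]] := Qd _ _ xm; have [q' [Qq' mq' q'y]] := Qd _ _ my.
have := near q xq (lt_trans qm my).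
have := near q' (le_trans (ltW xm) mq') q'y.
have lt_top (a b : T) : (a < b)%O -> a != \top%O.
  by apply: contraTneq => ->; rewrite -leNgt lex1.
rewrite (hE q Qq (lt_top _ _ qm)) (hE q' Qq' (lt_top _ _ q'y)).
rewrite mq' leNgt qm/= subr0 !ltr_norml => /andP[? ?] /andP[? ?]; lra.
Qed.

(** A point [m] of [M1] outside [M2] is impossible: the preimage of [ind R m] by the
    surjection [f1] is mapped by [f2] to a function that jumps at [m]. *)
Lemma recover_sub (V : Type) M1 M2 (QM1 : Q `<=` M1) (Mb1 : M1 \bot%O)
    (Mb2 : M2 \bot%O) (f1 : V -> Cspace R (cut M1)) (f2 : V -> Cspace R (cut M2))
    (g1 : Cspace R (cut M1) -> V) :
  Q `<=` M2 -> cancel g1 f1 ->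
  (forall v q, Q q -> f1 v (cut_upto Mb1 bt q) = f2 v (cut_upto Mb2 bt q)) ->
  M1 `<=` M2.
Proof.
move=> QM2 g1K f12 m Mm; apply: contrapT => nMm.
have nQm : ~ Q m by move=> /QM2.
apply: (@continuous_no_jump M2 Mb2 m (f2 (g1 (ind R m))) nQm nMm) => q Qq qt.
rewrite -f12// g1K; have [mq|qm] := leP m q.
  by rewrite ind1//; apply/cut_uptoE.
by rewrite ind0// => /(cut_uptoE Mb1 bt Mm qt); rewrite leNgt qm.
Qed.

(** An isomorphism from [C(cut M0)] onto [C(cut M)] is given by the functionals
    [f |-> F f (cut_upto q)], for [q] in [Q], and these determine [M]. *)
Lemma isomorphic_code (qq : nat -> T) (M0 : set T) :
  Q `<=` range qq -> embeds T bits -> Q `<=` M0 ->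
  exists code : set T -> bits, forall M1 M2, Q `<=` M1 -> Q `<=` M2 ->
    banach_isomorphic (Cspace R (cut M0)) (Cspace R (cut M1)) ->
    banach_isomorphic (Cspace R (cut M0)) (Cspace R (cut M2)) ->
    code M1 = code M2 -> M1 = M2.
Proof.
move=> Qqq Tb QM0.
have [phi_code phi_codeP] := @functional_code R _ _ Q M0 Qfill QM0 qq Qqq Tb.
have [enc encI] := embeds_seq_bits.
have /choice[code codeP] M : exists c : bits, Q `<=` M ->
    banach_isomorphic (Cspace R (cut M0)) (Cspace R (cut M)) ->
    exists (f : Cspace R (cut M0) -> Cspace R (cut M)) (Mb : M \bot%O),
      [/\ exists g, cancel g f,
        forall I, functional (fun v => f v I) &
        c = enc (fun n => phi_code (fun v => f v (cut_upto Mb bt (qq n))))].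
  have [[QM [f [g [_ gK [N fN] _]]]]|no] := pselect (Q `<=` M /\
    banach_isomorphic (Cspace R (cut M0)) (Cspace R (cut M))); last first.
    by exists (fun=> false) => QM iso; exfalso; apply: no.
  exists (enc (fun n => phi_code (fun v => f v (cut_upto (Qbot QM) bt (qq n))))).
  move=> _ _; exists f, (Qbot QM); split => //; first by exists g.
  move=> I; split; first by move=> a u v; rewrite linearP.
  exists `|N| => // v; apply: le_trans (le_Cnorm _ I) _.
  by apply: le_trans (fN v) _; rewrite ler_wpM2r// ler_norm.
exists code => M1 M2 QM1 QM2 iso1 iso2.
have [f1 [Mb1 [[g1 g1K] f1F ->]]] := codeP M1 QM1 iso1.
have [f2 [Mb2 [[g2 g2K] f2F ->]]] := codeP M2 QM2 iso2.
move=> /encI e12.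
have f12 v q : Q q -> f1 v (cut_upto Mb1 bt q) = f2 v (cut_upto Mb2 bt q).
  move=> /Qqq[n _ <-].
  exact: (phi_codeP _ _ (f1F _) (f2F _) (congr1 (@^~ n) e12)).
apply/seteqP; split.
  exact: (recover_sub QM1 QM2 g1K f12).
exact: (recover_sub QM2 QM1 g2K (fun v q Qq => esym (f12 v q Qq))).
Qed.

End Recover.

(** * The lexicographic order on binary sequences *)

(** Binary sequences, with the lexicographic order. *)
Definition lexbits := big_lexi_order (fun _ : nat => bool).

HB.instance Definition _ := Order.Total.on lexbits.
HB.instance Definition _ :=
  Order.BPOrder.copy lexbits (big_lexi_order (fun _ : nat => bool)).
HB.instance Definition _ :=
  Order.TPOrder.copy lexbits (big_lexi_order (fun _ : nat => bool)).

(** The pair [(s, b)] stands for the sequence [s] continued by the constant [b]. *)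
Definition eventually_constant : set lexbits :=
  range (fun sb : seq bool * bool => (fun n => nth sb.2 sb.1 n) : lexbits).

Lemma countable_eventually_constant : countable eventually_constant.
Proof.
apply: sub_countable (card_image_le _ _) _; exact: countableP.
Qed.

Lemma fills_eventually_constant : fills eventually_constant.
Proof.
split.
- by exists ([::], false) => //=; apply/funext => n; rewrite nth_nil.
- by exists ([::], true) => //=; apply/funext => n; rewrite nth_nil.
move=> x y; rewrite lt_neqAle leEbig_lexi_order => /andP[/eqP xy].
case xyn: (first_diff x y) => [n|]; last by move/first_diff_NoneP: xyn.
have [pxy xyN] := (first_diff_SomeP x y n).1 xyn.
move=> xyle; have {xyle xyN}[xn yn] : x n = false /\ y n = true.
  by move: xyle xyN; case: (x n); case: (y n).
(* [q] agrees with [x] up to the first difference [n], and is maximal after. *)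
pose q : lexbits := fun i => nth true (mkseq x n.+1) i.
have qE i : q i = if (i <= n)%N then x i else true.
  rewrite /q; case: leqP => ni; first by rewrite nth_mkseq.
  by rewrite nth_default// size_mkseq.
exists q; split.
- by exists (mkseq x n.+1, true).
- rewrite leEbig_lexi_order; case xqk: (first_diff x q) => [k|//].
  have [_] := (first_diff_SomeP x q k).1 xqk.
  by rewrite qE; case: leqP => _; [rewrite eqxx|case: (x k)].
have qyn : first_diff q y = Some n.
  apply/first_diff_SomeP; split; last by rewrite qE leqnn xn yn.
  by move=> i ni; rewrite qE (ltnW ni); exact: pxy.
rewrite lt_neqAle leEbig_lexi_order qyn qE leqnn xn yn/= andbT.
by apply/eqP => qy; move: (qE n); rewrite qy leqnn xn yn.
Qed.

(** The sequence [b, s 0, 0, s 1, 1, s 2, 0, s 3, 1, ...]; the alternating terms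
    keep it from being eventually constant. *)
Definition interleave (s : bits) (b : bool) : lexbits := fun n =>
  if n is n'.+1 then if odd n' then odd n'./2 else s n'./2 else b.

Lemma interleave_inj s t b c : interleave s b = interleave t c -> s = t /\ b = c.
Proof.
move=> e; split; last exact: (congr1 (@^~ 0%N) e).
apply/funext => n; have := congr1 (@^~ n.*2.+1) e.
by rewrite /interleave odd_double doubleK.
Qed.

Lemma interleave_not_constant s b : ~ eventually_constant (interleave s b).
Proof.
move=> [[t c] _ /= e].
have tail j : (size t <= j)%N -> odd j = c.
  move=> tj; have := congr1 (@^~ j.*2.+2) e.
  rewrite /interleave /= odd_double/= uphalf_double => <-.
  by rewrite nth_default// -addnn; apply: leq_trans tj _; rewrite !leqW// leq_addr.
by have := tail _ (leqnSn _); rewrite /= (tail _ (leqnn _)); case: c {e tail}.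
Qed.

Lemma embeds_set (A B : Type) : embeds A B -> embeds (set A) (set B).
Proof.
move=> [f fi]; exists (fun S => f @` S) => S S' e.
apply/seteqP; split => a Sa.
  by have [b Sb /fi <-] : (f @` S') (f a) by rewrite -e; exists a.
by have [b Sb /fi <-] : (f @` S) (f a) by rewrite e; exists a.
Qed.

Lemma embeds_set_bits : embeds (set nat) bits.
Proof.
exists (fun S n => `[< S n >]) => S S' e; apply/funext => n; apply/propext.
by rewrite -(asboolE (S n)) -(asboolE (S' n)) (congr1 (@^~ n) e).
Qed.

Lemma embeds_bits_set : embeds bits (set nat).
Proof.
exists (fun b => [set n | b n]) => b c e; apply/funext => n.
apply/idP/idP => bn; first by have : [set n | b n] n := bn; rewrite e.
by have : [set n | c n] n := bn; rewrite -e.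
Qed.

(** * A family of pairwise nonisomorphic spaces *)

Theorem theorem1p2 (R : realType) (K : Type)
  (hK : [set: K] #<= [set: set nat])
  (hK2 : card_lt [set: set nat] [set: set K]) :
  exists (d : Order.disp_t) (L : set K -> compactLineType d),
    (forall A : set K, separable_space (L A) /\ has_weight (L A) K) /\
    (forall A B : set K, A <> B ->
       ~ banach_isomorphic (Cspace R (L A)) (Cspace R (L B))).
Proof.
have nKbits : ~ embeds (set K) bits.
  move=> Kb; case/andP: hK2 => _ /negP; apply; apply/card_setTP.
  exact: embeds_trans Kb embeds_bits_set.
have [k kI] : embeds K bits.
  by move/card_setTP: hK => Kb; exact: embeds_trans Kb embeds_set_bits.
have nK : embeds nat K.
  have [//|Kn] := embeds_total nat K.
  exfalso; apply: nKbits; apply: embeds_trans embeds_set_bits.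
  exact: embeds_set.
have KnK : embeds (K * nat) K.
  exact: embeds_absorb (_ : 0%N <> 1%N) (embeds_countType _) nK.
pose Q := eventually_constant.
have Qfill : fills Q := fills_eventually_constant.
have [qq0 Qqq0] :=
  countable_sub_range (\bot%O : lexbits) countable_eventually_constant.
(* [M A] contains a copy of [K] for every [A], and a second copy of [A]. *)
pose M (A : set K) : set lexbits :=
  Q `|` [set interleave (k i.1) i.2 | i in [set i : K * bool | i.2 -> A i.1]].
have QM A : Q `<=` M A by move=> q Qq; left.
have bt : \bot%O != \top%O :> lexbits.
  by apply/eqP => /(congr1 (@^~ 0%N)).
have MI A B : M A = M B -> A `<=` B.
  move=> MAB a Aa; have : M A (interleave (k a) true) by right; exists (a, true).
  rewrite MAB => -[/interleave_not_constant//|[[b c] /= cB]].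
  by move=> /interleave_inj[/kI ba ct]; rewrite -ba; apply: cB; rewrite ct.
have code A : exists f : set K -> bits, forall B1 B2,
    banach_isomorphic (Cspace R (cut (M A))) (Cspace R (cut (M B1))) ->
    banach_isomorphic (Cspace R (cut (M A))) (Cspace R (cut (M B2))) ->
    f B1 = f B2 -> B1 = B2.
  have [f fP] := @isomorphic_code R _ _ Q Qfill bt qq0 (M A) Qqq0
    (ex_intro _ id (fun _ _ => id)) (QM A).
  exists (f \o M) => B1 B2 i1 i2 /(fP _ _ (QM B1) (QM B2) i1 i2) M12.
  by apply/seteqP; split; apply: MI.
have bits01 : (fun=> false) <> (fun=> true) :> bits by move/(congr1 (@^~ 0%N)).
have [j jP] := @inequivalent_family (set K) bits
  (fun A B => banach_isomorphic (Cspace R (cut (M A))) (Cspace R (cut (M B))))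
  _ _ bits01 embeds_pair_bits (fun A => banach_isomorphic_refl _)
  (fun A B => @banach_isomorphic_sym _ _ _)
  (fun A B C => @banach_isomorphic_trans _ _ _ _) code nKbits.
exists (Order.Disp tt tt), (fun A => cut (M (j A))); split=> [A|]; last exact: jP.
split; first exact: separable_cut (QM _) bt countable_eventually_constant.
have [k0 _] := nK.
(* [M (j A)] is covered by two copies of [K] and the countable set [Q]. *)
pose e (i : K * nat) : lexbits := match i.2 with
  | 0%N => interleave (k i.1) false
  | 1%N => interleave (k i.1) true
  | n.+2 => qq0 n
  end.
apply: (@weight_cut _ lexbits Q _ Qfill (QM _) bt K
  (fun a => interleave (k a) false) e qq0 KnK) => //.
- by move=> a b /interleave_inj[/kI].
- move=> a; split; first by right; exists (a, false).
  by have [] := fills_neq Qfill (@interleave_not_constant (k a) false).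
move=> _ [/Qqq0[n _ <-]|[[a [] /=] _ <-]].
- by exists (k0 0%N, n.+2).
- by exists (a, 1%N).
- by exists (a, 0%N).
Qed.
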